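(* Suppose there is an algorithm which, given any integer linear recurrence sequence $\langle u_n\rangle_{n=0}^\infty$ of order $6$, decides whether $u_n\ge 0$ for all $n\ge 0$ (i.e. the Positivity Problem is decidable for integer LRS of order $6$). Then for every $t\in\mathcal{T}$, the type $L(t)$ is a computable real number.
   Context: An integer linear recurrence sequence (LRS) of order $k$ is a sequence $\langle u_n\rangle_{n=0}^\infty$ of integers for which there are integers $a_1,\ldots,a_k$ with $a_k\ne 0$ such that $u_{n+k}=a_1u_{n+k-1}+\cdots+a_ku_n$ for all $n\ge0$; it is given as input by the $2k$-tuple $(a_1,\ldots,a_k,u_0,\ldots,u_{k-1})$. For a real number $x$, the (homogeneous Diophantine approximation) type is $L(x)=\inf\{c\in\mathbb{R}: |x-\frac{n}{m}|<\frac{c}{m^2} \text{ for some } n,m\in\mathbb{Z},\ m\neq 0\}$. Let $\mathcal{A}=\{p+qi\in\mathbb{C}: p,q\in\mathbb{Q},\ p^2+q^2=1,\ p\neq 0,\ q\neq 0\}$, and let $\mathcal{T}=\{\frac{\arg\alpha}{2\pi}:\alpha\in\mathcal{A}\}$, where $\arg$ denotes the principal argument with values in $(-\pi,\pi]$. A real number $x$ is computable if there is an algorithm which, given any rational $\varepsilon>0$, returns a rational $q$ with $|q-x|<\varepsilon$. *)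

(* Defs.v *)
From Stdlib Require Import Reals ZArith QArith Qreals Lia Lra.
Open Scope R_scope.

(** * A model of computation: partial mu-recursive functions on nat
    (unary, with Cantor pairing to encode tuples).  "Algorithm" in the
    paper is read as "program of this Turing-complete language". *)

Definition cpair (a b : nat) : nat :=
  (((a + b) * (a + b + 1)) / 2 + b)%nat.

Inductive prog : Type :=
  | PZero : prog
  | PSucc : prog
  | PId   : prog
  | PFst  : prog
  | PSnd  : prog
  | PComp : prog -> prog -> prog
  | PPair : prog -> prog -> prog
  | PRec  : prog -> prog -> prog
  | PMu   : prog -> prog.

Inductive eval : prog -> nat -> nat -> Prop :=
  | ev_zero x : eval PZero x 0
  | ev_succ x : eval PSucc x (S x)
  | ev_id x : eval PId x x
  | ev_fst a b : eval PFst (cpair a b) a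
  | ev_snd a b : eval PSnd (cpair a b) b
  | ev_comp f g x y z : eval g x y -> eval f y z -> eval (PComp f g) x z
  | ev_pair f g x a b : eval f x a -> eval g x b -> eval (PPair f g) x (cpair a b)
  | ev_rec0 f g x y : eval f x y -> eval (PRec f g) (cpair x 0) y
  | ev_recS f g x n y z :
      eval (PRec f g) (cpair x n) y ->
      eval g (cpair x (cpair n y)) z ->
      eval (PRec f g) (cpair x (S n)) z
  | ev_mu f x n :
      eval f (cpair x n) 0 ->
      (forall m, (m < n)%nat -> exists k, eval f (cpair x m) (S k)) ->
      eval (PMu f) x n.

Definition zenc (z : Z) : nat :=
  match z with
  | Z0 => 0%nat
  | Zpos p => (2 * Pos.to_nat p)%nat
  | Zneg p => (2 * Pos.to_nat p - 1)%nat
  end.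

Fixpoint zlist_enc (l : list Z) : nat :=
  match l with
  | nil => 0%nat
  | cons z l' => cpair (zenc z) (zlist_enc l')
  end.

Definition denotes_rat (code : nat) (r : R) : Prop :=
  exists (a : Z) (b : nat), code = cpair (zenc a) b /\
    r = IZR a / INR (S b).

Definition state6 : Type := (Z * Z * Z * Z * Z * Z)%type.

Definition lrs6_step (a1 a2 a3 a4 a5 a6 : Z) (s : state6) : state6 :=
  match s with
  | (x0, x1, x2, x3, x4, x5) =>
      (x1, x2, x3, x4, x5,
       (a1 * x5 + a2 * x4 + a3 * x3 + a4 * x2 + a5 * x1 + a6 * x0)%Z)
  end.

Definition lrs6 (a1 a2 a3 a4 a5 a6 u0 u1 u2 u3 u4 u5 : Z) (n : nat) : Z :=
  match Nat.iter n (lrs6_step a1 a2 a3 a4 a5 a6) (u0, u1, u2, u3, u4, u5) with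
  | (x0, _, _, _, _, _) => x0
  end.

Definition positivity6_decidable : Prop :=
  exists P : prog,
    forall a1 a2 a3 a4 a5 a6 u0 u1 u2 u3 u4 u5 : Z,
      a6 <> 0%Z ->
      let code := zlist_enc (a1 :: a2 :: a3 :: a4 :: a5 :: a6 ::
                             u0 :: u1 :: u2 :: u3 :: u4 :: u5 :: nil) in
      ((forall n, (0 <= lrs6 a1 a2 a3 a4 a5 a6 u0 u1 u2 u3 u4 u5 n)%Z) ->
          eval P code 1) /\
      (~ (forall n, (0 <= lrs6 a1 a2 a3 a4 a5 a6 u0 u1 u2 u3 u4 u5 n)%Z) ->
          eval P code 0).

Definition computable_real (x : R) : Prop :=
  exists Q : prog, forall k d : nat,
    exists out q, eval Q (cpair k d) out /\ denotes_rat out q /\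
      Rabs (q - x) < INR (S k) / INR (S d).

Definition is_inf (S : R -> Prop) (l : R) : Prop :=
  (forall c, S c -> l <= c) /\
  (forall l', (forall c, S c -> l' <= c) -> l' <= l).

Definition approx_set (x : R) (c : R) : Prop :=
  exists n m : Z, m <> 0%Z /\
    Rabs (x - IZR n / IZR m) < c / (IZR m) ^ 2.

Definition dio_type (x l : R) : Prop := is_inf (approx_set x) l.

(** t in T: t = arg(p + q i) / (2 pi) for rational p, q nonzero,
    p^2 + q^2 = 1, with arg the principal argument in (-pi, pi]. *)
Definition in_T (t : R) : Prop :=
  exists p q : Q,
    (p * p + q * q == 1)%Q /\ ~ (p == 0)%Q /\ ~ (q == 0)%Q /\
    exists theta : R,
      - PI < theta /\ theta <= PI /\
      cos theta = Q2R p /\ sin theta = Q2R q /\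
      t = theta / (2 * PI).

(* Main.v *)
Require Import Defs.
From Stdlib Require Import Reals ZArith QArith Qreals Lia Lra List Cantor Classical.
Open Scope R_scope.

(** With [theta = 2 PI t], the type of [t] is the infimum [l] of [n |n t - m|] over
    [n > 0] and integers [m].

    Writing [z = PI (n t - m)],
    [n (1 - cos (n theta)) - r sin (n theta) = 2 sin z (n sin z - r cos z)],
    so the left-hand side is nonnegative for all [n], both for [t] and for [- t], as soon
    as [r <= PI l].  If the infimum is not attained, it is approached with arbitrarily
    large [n], hence small [z], and for [r > PI l] one of the two sequences takes a
    negative value.  The sign for which this happens for all [r > PI l] can be fixed
    once and for all, since the tests are monotone in [r].  After scaling by [c ^ n], where
    [c] is a common denominator of [cos theta] and [sin theta], the sequence is an integer
    linear recurrence of order 6, so that the oracle decides [r <= PI l] (up to the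
    boundary case) for rational [r >= 0].

    If the infimum is attained at [n], then [PI l / n] is the argument of a Gaussian
    integer; otherwise [PI l] is close to [n arctan (r / n)] for a large [n] and a rational
    [r] found with the oracle.  In both cases it remains to compute [y / PI] for the argument [y] of
    a given Gaussian integer, which is done by counting the half turns made by its
    powers. *)

(** * Pairing and closure properties of the total computable functions *)

Definition cfst (x : nat) : nat := fst (Cantor.of_nat x).
Definition csnd (x : nat) : nat := snd (Cantor.of_nat x).

Lemma cpair_to_nat (a b : nat) : cpair a b = Cantor.to_nat (a, b).
Proof.
  unfold cpair. pose proof (Cantor.to_nat_spec a b) as H.
  assert (E : ((a + b) * (a + b + 1) = (Cantor.to_nat (a, b) - b) * 2)%nat) by nia.
  rewrite E, Nat.div_mul by lia. nia.
Qed.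

Lemma cfst_cpair (a b : nat) : cfst (cpair a b) = a.
Proof. unfold cfst. now rewrite cpair_to_nat, Cantor.cancel_of_to. Qed.

Lemma csnd_cpair (a b : nat) : csnd (cpair a b) = b.
Proof. unfold csnd. now rewrite cpair_to_nat, Cantor.cancel_of_to. Qed.

Lemma cpair_proj (x : nat) : cpair (cfst x) (csnd x) = x.
Proof.
  unfold cfst, csnd. rewrite cpair_to_nat, <- surjective_pairing.
  apply Cantor.cancel_to_of.
Qed.

Definition computable (f : nat -> nat) : Prop :=
  exists p, forall x, eval p x (f x).

Lemma computable_ext (f g : nat -> nat) :
  (forall x, f x = g x) -> computable f -> computable g.
Proof. intros E [p Hp]. exists p. intro x. rewrite <- E. apply Hp. Qed.

Lemma computable_id : computable (fun x => x).
Proof. exists PId. constructor. Qed.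

Lemma computable_comp (f g : nat -> nat) :
  computable f -> computable g -> computable (fun x => f (g x)).
Proof.
  intros [p Hp] [q Hq]. exists (PComp p q). intro x. now apply ev_comp with (g x).
Qed.

Lemma computable_S (f : nat -> nat) : computable f -> computable (fun x => S (f x)).
Proof. apply (computable_comp S). exists PSucc. constructor. Qed.

Lemma computable_const (c : nat) : computable (fun _ => c).
Proof.
  induction c; [exists PZero; constructor|]. now apply computable_S.
Qed.

Lemma computable_pair (f g : nat -> nat) :
  computable f -> computable g -> computable (fun x => cpair (f x) (g x)).
Proof. intros [p Hp] [q Hq]. exists (PPair p q). intro x. now constructor. Qed.

Lemma computable_cfst (f : nat -> nat) : computable f -> computable (fun x => cfst (f x)).
Proof.
  apply (computable_comp cfst). exists PFst. intro x.
  rewrite <- (cpair_proj x) at 1. constructor.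
Qed.

Lemma computable_csnd (f : nat -> nat) : computable f -> computable (fun x => csnd (f x)).
Proof.
  apply (computable_comp csnd). exists PSnd. intro x.
  rewrite <- (cpair_proj x) at 1. constructor.
Qed.

(** The iteration count [h x] may depend on the input, and the step function receives input, index
    and accumulator packed exactly as [PRec] packs them. Arithmetic, case distinction and the turn
    counter are all instances. *)
Lemma computable_rec (f g h : nat -> nat) :
  computable f -> computable g -> computable h ->
  computable (fun x => nat_rec (fun _ => nat) (f x)
                         (fun i r => g (cpair x (cpair i r))) (h x)).
Proof.
  intros [p Hp] [q Hq] [s Hs].
  exists (PComp (PRec p q) (PPair PId s)). intro x.
  apply ev_comp with (cpair x (h x)); [constructor; [constructor | apply Hs]|].
  induction (h x) as [|n IH]; [now constructor|].
  simpl. econstructor; [exact IH | apply Hq].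
Qed.

Lemma computable_add (f g : nat -> nat) :
  computable f -> computable g -> computable (fun x => f x + g x)%nat.
Proof.
  intros Hf Hg.
  apply computable_ext with (fun x => nat_rec (fun _ => nat) (f x)
    (fun i r => S (csnd (csnd (cpair x (cpair i r))))) (g x)).
  - intro x. induction (g x) as [|n IH]; simpl; [lia|]. rewrite !csnd_cpair, IH. lia.
  - apply computable_rec with (g := fun z => S (csnd (csnd z))); trivial.
    apply computable_S, computable_csnd, computable_csnd, computable_id.
Qed.

Lemma computable_mul (f g : nat -> nat) :
  computable f -> computable g -> computable (fun x => f x * g x)%nat.
Proof.
  intros Hf Hg.
  apply computable_ext with (fun x => nat_rec (fun _ => nat) 0%nat
    (fun i r => csnd (csnd (cpair x (cpair i r))) + f (cfst (cpair x (cpair i r))))%nat (g x)).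
  - intro x. induction (g x) as [|n IH]; simpl; [lia|].
    rewrite !csnd_cpair, cfst_cpair, IH. lia.
  - apply computable_rec with (g := fun z => (csnd (csnd z) + f (cfst z))%nat); trivial.
    + apply computable_const.
    + apply computable_add.
      * apply computable_csnd, computable_csnd, computable_id.
      * apply computable_comp; [assumption | apply computable_cfst, computable_id].
Qed.

Lemma computable_pred (f : nat -> nat) : computable f -> computable (fun x => Nat.pred (f x)).
Proof.
  intro Hf.
  apply computable_ext with (fun x => nat_rec (fun _ => nat) 0%nat
    (fun i r => cfst (csnd (cpair x (cpair i r)))) (f x)).
  - intro x. destruct (f x); simpl; [reflexivity|]. now rewrite csnd_cpair, cfst_cpair.
  - apply computable_rec with (g := fun z => cfst (csnd z)); trivial.
    + apply computable_const.
    + apply computable_cfst, computable_csnd, computable_id.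
Qed.

Lemma computable_sub (f g : nat -> nat) :
  computable f -> computable g -> computable (fun x => f x - g x)%nat.
Proof.
  intros Hf Hg.
  apply computable_ext with (fun x => nat_rec (fun _ => nat) (f x)
    (fun i r => Nat.pred (csnd (csnd (cpair x (cpair i r))))) (g x)).
  - intro x. induction (g x) as [|n IH]; simpl; [lia|]. rewrite !csnd_cpair, IH. lia.
  - apply computable_rec with (g := fun z => Nat.pred (csnd (csnd z))); trivial.
    apply computable_pred, computable_csnd, computable_csnd, computable_id.
Qed.

Definition ifz (c x y : nat) : nat := match c with O => x | S _ => y end.

Lemma computable_ifz (c f g : nat -> nat) :
  computable c -> computable f -> computable g ->
  computable (fun x => ifz (c x) (f x) (g x)).
Proof.
  intros Hc Hf Hg.
  apply computable_ext with (fun x => nat_rec (fun _ => nat) (f x)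
    (fun i r => g (cfst (cpair x (cpair i r)))) (c x)).
  - intro x. destruct (c x); simpl; [reflexivity|]. now rewrite cfst_cpair.
  - apply computable_rec with (g := fun z => g (cfst z)); trivial.
    apply computable_comp; [assumption | apply computable_cfst, computable_id].
Qed.

Create HintDb computable.
#[export] Hint Resolve computable_id computable_const computable_pair computable_cfst
  computable_csnd computable_add computable_mul computable_sub computable_ifz
  computable_S : computable.

(** * Approximating an angle by counting half turns *)

(* The Gaussian integer [(u1 - u2) + v i], of argument in [[0, PI]], together with
   the number of half turns completed so far; differences of naturals avoid signs. *)
Definition turn_state (u1 u2 v count : nat) : nat := cpair (cpair u1 u2) (cpair v count).

(** Multiplication by [X + Y i]. The truncated difference tested is zero exactly when the new
    imaginary part is nonnegative; otherwise the product is negated, which removes a half turn, and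
    the count goes up. *)
Definition turn_step (X Y s : nat) : nat :=
  let u1 := cfst (cfst s) in
  let u2 := csnd (cfst s) in
  let v := cfst (csnd s) in
  let count := csnd (csnd s) in
  ifz (u2 * Y - (u1 * Y + v * X))
    (turn_state (u1 * X) (u2 * X + v * Y) (u1 * Y + v * X - u2 * Y) count)
    (turn_state (u2 * X + v * Y) (u1 * X) (u2 * Y - (u1 * Y + v * X)) (S count)).

Definition turns (X Y K : nat) : nat :=
  nat_rec (fun _ => nat) (turn_state 1 0 0 0) (fun _ s => turn_step X Y s) K.

Definition half_turns (X Y K : nat) : nat := csnd (csnd (turns X Y K)).

Lemma computable_half_turns (f g h : nat -> nat) :
  computable f -> computable g -> computable h ->
  computable (fun x => half_turns (f x) (g x) (h x)).
Proof.
  intros Hf Hg Hh. unfold half_turns. apply computable_csnd, computable_csnd.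
  set (G := fun z => turn_step (f (cfst z)) (g (cfst z)) (csnd (csnd z))).
  apply computable_ext with (fun x => nat_rec (fun _ => nat) (turn_state 1 0 0 0)
    (fun i r => G (cpair x (cpair i r))) (h x)).
  - intro x. unfold turns. induction (h x) as [|n IH]; [reflexivity|].
    simpl. rewrite IH. unfold G. now rewrite cfst_cpair, !csnd_cpair.
  - apply computable_rec; trivial; [apply computable_const|].
    assert (Hf' : computable (fun z => f (cfst z)))
      by (apply computable_comp; auto with computable).
    assert (Hg' : computable (fun z => g (cfst z)))
      by (apply computable_comp; auto with computable).
    unfold G, turn_step, turn_state. auto 12 with computable.
Qed.

(** Since [phi + y <= PI + PI / 2 < 2 * PI], a step completes at most one half turn, and the sign of
    [sin (phi + y)] tells whether it does. *)
Lemma turns_spec (X Y : nat) (y rho : R) :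
  0 <= y <= PI / 2 -> 0 < rho -> INR X = rho * cos y -> INR Y = rho * sin y ->
  forall K, exists u1 u2 v count phi r,
    turns X Y K = turn_state u1 u2 v count /\
    0 <= phi <= PI /\ 0 < r /\ INR K * y = INR count * PI + phi /\
    INR u1 - INR u2 = r * cos phi /\ INR v = r * sin phi.
Proof.
  intros Hy Hrho HX HY K. pose proof PI_RGT_0 as HPI.
  induction K as [|K (u1 & u2 & v & count & phi & r & E & Hphi & Hr & HK & Hu & Hv)].
  - exists 1%nat, 0%nat, 0%nat, 0%nat, 0, 1. simpl INR.
    rewrite cos_0, sin_0. repeat split; lra.
  - set (a := (u1 * Y + v * X)%nat). set (b := (u2 * Y)%nat).
    assert (Him : INR a - INR b = r * rho * sin (phi + y)).
    { unfold a, b. rewrite plus_INR, !mult_INR, sin_plus, HX, HY, Hv.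
      replace (INR u1) with (r * cos phi + INR u2) by lra. ring. }
    assert (Hre : INR (u1 * X) - INR (u2 * X + v * Y) = r * rho * cos (phi + y)).
    { rewrite plus_INR, !mult_INR, cos_plus, HX, HY, Hv.
      replace (INR u1) with (r * cos phi + INR u2) by lra. ring. }
    assert (Hrr : 0 < r * rho) by (apply Rmult_lt_0_compat; lra).
    assert (Est : turns X Y (S K) = ifz (b - a)
      (turn_state (u1 * X) (u2 * X + v * Y) (a - b) count)
      (turn_state (u2 * X + v * Y) (u1 * X) (b - a) (S count))).
    { change (turns X Y (S K)) with (turn_step X Y (turns X Y K)).
      rewrite E. unfold turn_step, turn_state.
      repeat rewrite ?cfst_cpair, ?csnd_cpair. reflexivity. }
    rewrite Est. destruct (b - a)%nat as [|e] eqn:Eba.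
    + assert (Hle : (b <= a)%nat) by lia.
      assert (Hpos : 0 <= r * rho * sin (phi + y)).
      { rewrite <- Him. apply le_INR in Hle. lra. }
      do 4 eexists. exists (phi + y), (r * rho). repeat split.
      * lra.
      * destruct (Rle_lt_dec (phi + y) PI) as [H|H]; [exact H|].
        assert (sin (phi + y) < 0) by (apply sin_lt_0; lra). nra.
      * lra.
      * rewrite S_INR. lra.
      * exact Hre.
      * rewrite minus_INR by lia. exact Him.
    + assert (Hlt : (a < b)%nat) by lia.
      assert (Hneg : r * rho * sin (phi + y) < 0).
      { rewrite <- Him. apply lt_INR in Hlt. lra. }
      assert (Hturn : PI < phi + y).
      { destruct (Rle_lt_dec (phi + y) PI) as [H|H]; [|exact H].
        assert (0 <= sin (phi + y)) by (apply sin_ge_0; lra). nra. }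
      assert (Hc : cos (phi + y - PI) = - cos (phi + y)).
      { pose proof (neg_cos (phi + y - PI)) as H.
        replace (phi + y - PI + PI) with (phi + y) in H by ring. lra. }
      assert (Hs : sin (phi + y - PI) = - sin (phi + y)).
      { pose proof (neg_sin (phi + y - PI)) as H.
        replace (phi + y - PI + PI) with (phi + y) in H by ring. lra. }
      do 4 eexists. exists (phi + y - PI), (r * rho). repeat split.
      * lra.
      * lra.
      * lra.
      * rewrite !S_INR. lra.
      * rewrite Hc. lra.
      * rewrite Hs, <- Eba, minus_INR by lia. lra.
Qed.

Lemma half_turns_approx (X Y : nat) (y rho : R) (K : nat) :
  0 <= y <= PI / 2 -> 0 < rho -> INR X = rho * cos y -> INR Y = rho * sin y ->
  Rabs (INR (half_turns X Y K) - INR K * (y / PI)) <= 1.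
Proof.
  intros Hy Hrho HX HY. pose proof PI_RGT_0 as HPI.
  destruct (turns_spec X Y y rho Hy Hrho HX HY K)
    as (u1 & u2 & v & count & phi & r & E & Hphi & _ & HK & _).
  unfold half_turns. rewrite E. unfold turn_state. rewrite !csnd_cpair.
  assert (Hq : 0 <= phi / PI <= 1).
  { split; [apply Rle_mult_inv_pos; lra|].
    apply Rmult_le_reg_r with PI; [lra|]. unfold Rdiv.
    rewrite Rmult_assoc, Rinv_l by lra. lra. }
  replace (INR K * (y / PI)) with (INR count + phi / PI).
  - apply Rabs_le. lra.
  - unfold Rdiv. rewrite <- Rmult_assoc, HK. field. lra.
Qed.
(** * Linear recurrences of order 6 built from a rational point of the circle *)

Fixpoint gauss_pow (a b : Z) (n : nat) : Z * Z :=
  match n with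
  | O => (1, 0)%Z
  | S n => let (x, y) := gauss_pow a b n in (a * x - b * y, b * x + a * y)%Z
  end.

Lemma gauss_pow_polar (a b : Z) (c theta : R) (n : nat) :
  IZR a = c * cos theta -> IZR b = c * sin theta ->
  IZR (fst (gauss_pow a b n)) = c ^ n * cos (INR n * theta) /\
  IZR (snd (gauss_pow a b n)) = c ^ n * sin (INR n * theta).
Proof.
  intros Ha Hb. induction n as [|n [IH1 IH2]].
  - simpl. rewrite Rmult_0_l, cos_0, sin_0. lra.
  - rewrite S_INR, Rmult_plus_distr_r, Rmult_1_l, cos_plus, sin_plus.
    simpl. destruct (gauss_pow a b n) as [x y]. simpl in *.
    rewrite minus_IZR, plus_IZR, !mult_IZR, IH1, IH2, Ha, Hb. split; ring.
Qed.

(* When [a + b i = c exp(i theta)], this is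
   [c ^ n * (D * n * (1 - cos (n * theta)) - j * sin (n * theta))]. *)
Definition circle_lrs (a b c D j : Z) (n : nat) : Z :=
  (D * (Z.of_nat n * (Zpower_nat c n - fst (gauss_pow a b n)))
   - j * snd (gauss_pow a b n))%Z.

(* The characteristic polynomial is [((x - c) (x^2 - 2 a x + a^2 + b^2)) ^ 2],
   where [(x - c) (x^2 - 2 a x + a^2 + b^2) = x^3 - s x^2 + p x - q]. *)
Lemma circle_lrs_rec (a b c D j : Z) (n : nat) :
  let s := (c + 2 * a)%Z in
  let p := (a * a + b * b + 2 * a * c)%Z in
  let q := (c * (a * a + b * b))%Z in
  let u := circle_lrs a b c D j in
  (u (6 + n)%nat = 2 * s * u (5 + n)%nat + - (s * s + 2 * p) * u (4 + n)%nat
    + (2 * q + 2 * s * p) * u (3 + n)%nat + - (p * p + 2 * s * q) * u (2 + n)%nat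
    + 2 * p * q * u (1 + n)%nat + - (q * q) * u n)%Z.
Proof.
  intros s p q u. subst s p q u. unfold circle_lrs.
  rewrite !Nat2Z.inj_add. simpl Nat.add. cbn [gauss_pow Zpower_nat nat_rect].
  rewrite ?Zpower_nat_succ_r.
  destruct (gauss_pow a b n) as [x y]. cbn [fst snd].
  set (C := Zpower_nat c n). set (N := Z.of_nat n).
  change (Z.of_nat 6) with 6%Z. change (Z.of_nat 5) with 5%Z. change (Z.of_nat 4) with 4%Z.
  change (Z.of_nat 3) with 3%Z. change (Z.of_nat 2) with 2%Z. change (Z.of_nat 1) with 1%Z.
  ring.
Qed.

Lemma lrs6_unique (a1 a2 a3 a4 a5 a6 : Z) (u : nat -> Z) :
  (forall n, u (6 + n)%nat = a1 * u (5 + n)%nat + a2 * u (4 + n)%nat + a3 * u (3 + n)%nat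
    + a4 * u (2 + n)%nat + a5 * u (1 + n)%nat + a6 * u n)%Z ->
  forall n, lrs6 a1 a2 a3 a4 a5 a6 (u 0%nat) (u 1%nat) (u 2%nat) (u 3%nat) (u 4%nat) (u 5%nat) n
    = u n.
Proof.
  intros Hu n. unfold lrs6.
  replace (Nat.iter n _ _)
    with (u n, u (1 + n)%nat, u (2 + n)%nat, u (3 + n)%nat, u (4 + n)%nat, u (5 + n)%nat);
    [reflexivity|].
  induction n as [|n IH]; [reflexivity|].
  rewrite Nat.iter_succ, <- IH. cbn [lrs6_step].
  rewrite <- Hu. now rewrite !Nat.add_succ_r.
Qed.

Definition angle_test (theta r : R) : Prop :=
  forall n, r * sin (INR n * theta) <= INR n * (1 - cos (INR n * theta)).

Lemma circle_lrs_nonneg_iff (a b c : Z) (theta : R) (D j : nat) :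
  (0 < c)%Z -> IZR a = IZR c * cos theta -> IZR b = IZR c * sin theta -> (0 < D)%nat ->
  (forall n, 0 <= circle_lrs a b c (Z.of_nat D) (Z.of_nat j) n)%Z <->
  angle_test theta (INR j / INR D).
Proof.
  intros Hc Ha Hb HD. apply IZR_lt in Hc. apply lt_INR in HD. simpl in HD.
  assert (E : forall n, IZR (circle_lrs a b c (Z.of_nat D) (Z.of_nat j) n)
    = IZR c ^ n * INR D *
      (INR n * (1 - cos (INR n * theta)) - INR j / INR D * sin (INR n * theta))).
  { intro n. destruct (gauss_pow_polar a b (IZR c) theta n Ha Hb) as [E1 E2].
    unfold circle_lrs. rewrite minus_IZR, !mult_IZR, minus_IZR, E1, E2, <- !INR_IZR_INZ.
    rewrite Zpower_nat_Z, <- pow_IZR. field. lra. }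
  assert (Hpos : forall n, 0 < IZR c ^ n * INR D)
    by (intro n; apply Rmult_lt_0_compat; [now apply pow_lt | assumption]).
  split; intros H n; specialize (H n); specialize (E n); specialize (Hpos n).
  - apply IZR_le in H. rewrite E in H.
    destruct (Rle_lt_dec (INR j / INR D * sin (INR n * theta))
                (INR n * (1 - cos (INR n * theta)))); [assumption|]. nra.
  - apply le_IZR. rewrite E. apply Rmult_le_pos; lra.
Qed.

(** [zenc] sends nonnegative integers to even codes and negative ones to odd codes. At most one of
    the truncated differences is nonzero, and [2 * 0 - 1] is [0] on naturals. *)
Lemma zenc_sub (x y : nat) :
  zenc (Z.of_nat x - Z.of_nat y) = (2 * (x - y) + (2 * (y - x) - 1))%nat.
Proof.
  destruct (Z.of_nat x - Z.of_nat y)%Z eqn:E; simpl zenc; lia.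
Qed.

(** For fixed [n], [circle_lrs] is a linear form in [D] and [j] with constant integer coefficients.
    Splitting these by sign turns the form into a difference of naturals. *)
Lemma computable_zenc_linear (E F : Z) (f g : nat -> nat) :
  computable f -> computable g ->
  computable (fun x => zenc (E * Z.of_nat (f x) + F * Z.of_nat (g x))).
Proof.
  intros Hf Hg.
  set (pos := fun x => (Z.to_nat E * f x + Z.to_nat F * g x)%nat).
  set (neg := fun x => (Z.to_nat (- E) * f x + Z.to_nat (- F) * g x)%nat).
  apply computable_ext with (fun x => 2 * (pos x - neg x) + (2 * (neg x - pos x) - 1))%nat.
  - intro x. rewrite <- zenc_sub. f_equal. unfold pos, neg. nia.
  - unfold pos, neg. auto 12 with computable.
Qed.

(** The recurrence coefficients do not depend on [x]; only the six initial values have to be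
    computed before the oracle is called. *)
Lemma angle_test_decidable (a b c : Z) (theta : R) (D j : nat -> nat) :
  positivity6_decidable ->
  (0 < c)%Z -> IZR a = IZR c * cos theta -> IZR b = IZR c * sin theta ->
  computable D -> computable j -> (forall x, (0 < D x)%nat) ->
  exists p, forall x,
    (angle_test theta (INR (j x) / INR (D x)) -> eval p x 1) /\
    (~ angle_test theta (INR (j x) / INR (D x)) -> eval p x 0).
Proof.
  intros [P HP] Hc Ha Hb HcD Hcj HD.
  set (s := (c + 2 * a)%Z).
  set (p := (a * a + b * b + 2 * a * c)%Z).
  set (q := (c * (a * a + b * b))%Z).
  set (u := fun x => circle_lrs a b c (Z.of_nat (D x)) (Z.of_nat (j x))).
  (* The last coefficient is nonzero because [a * a + b * b = c * c], so that [q] is the cube of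
     [c]. *)
  assert (Hq : (- (q * q) <> 0)%Z).
  { assert (HN : (a * a + b * b = c * c)%Z).
    { apply eq_IZR. rewrite plus_IZR, !mult_IZR, Ha, Hb.
      pose proof (sin2_cos2 theta) as H. unfold Rsqr in H.
      transitivity (IZR c * IZR c * (sin theta * sin theta + cos theta * cos theta)); [ring|].
      rewrite H. ring. }
    unfold q. rewrite HN. nia. }
  assert (Hu : forall n, computable (fun x => zenc (u x n))).
  { intro n.
    apply computable_ext with (fun x =>
      zenc (Z.of_nat n * (Zpower_nat c n - fst (gauss_pow a b n)) * Z.of_nat (D x)
            + - snd (gauss_pow a b n) * Z.of_nat (j x))).
    - intro x. f_equal. unfold u, circle_lrs. ring.
    - now apply computable_zenc_linear. }
  assert (Hcode : computable (fun x => zlist_enc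
    (2 * s :: - (s * s + 2 * p) :: 2 * q + 2 * s * p :: - (p * p + 2 * s * q)
      :: 2 * p * q :: - (q * q)
      :: u x 0%nat :: u x 1%nat :: u x 2%nat :: u x 3%nat :: u x 4%nat :: u x 5%nat :: nil)%Z)).
  { cbn [zlist_enc]. repeat apply computable_pair; auto using computable_const. }
  destruct Hcode as [pc Hpc].
  exists (PComp P pc). intro x.
  specialize (HP (2 * s) (- (s * s + 2 * p)) (2 * q + 2 * s * p) (- (p * p + 2 * s * q))
    (2 * p * q) _ (u x 0%nat) (u x 1%nat) (u x 2%nat) (u x 3%nat) (u x 4%nat)
    (u x 5%nat) Hq)%Z.
  assert (Hiff : angle_test theta (INR (j x) / INR (D x)) <-> forall n, (0 <=
    lrs6 (2 * s) (- (s * s + 2 * p)) (2 * q + 2 * s * p) (- (p * p + 2 * s * q)) (2 * p * q)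
      (- (q * q)) (u x 0%nat) (u x 1%nat) (u x 2%nat) (u x 3%nat) (u x 4%nat) (u x 5%nat) n)%Z).
  { rewrite <- (circle_lrs_nonneg_iff a b c theta (D x) (j x) Hc Ha Hb (HD x)).
    pose proof (lrs6_unique _ _ _ _ _ _ (u x) (circle_lrs_rec a b c (Z.of_nat (D x)) (Z.of_nat (j x))))
      as E.
    split; intros H n; specialize (H n); [rewrite E | rewrite E in H]; exact H. }
  destruct HP as [H1 H0].
  split; intro H; apply ev_comp with (1 := Hpc x).
  - apply H1, Hiff, H.
  - apply H0. intro H'. apply H, Hiff, H'.
Qed.
(** * Computing the type *)

Lemma least_witness (P : nat -> Prop) :
  (exists n, P n) -> exists n, P n /\ forall m, (m < n)%nat -> ~ P m.
Proof.
  intros HP.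
  destruct (dec_inh_nat_subset_has_unique_least_element P (fun n => classic (P n)) HP)
    as [n [[Hn Hmin] _]].
  exists n. split; [exact Hn|]. intros m Hm HPm. specialize (Hmin m HPm). lia.
Qed.

Lemma sin_le_id (x : R) : 0 <= x -> sin x <= x.
Proof.
  intros [H| <-]; [now apply Rlt_le, sin_lt_x | rewrite sin_0; lra].
Qed.

(** The function [sin z - z * cos z] vanishes at [0] and has derivative [z * sin z], nonnegative on
    [[0, PI]]. *)
Lemma id_cos_le_sin (x : R) : 0 <= x <= PI -> x * cos x <= sin x.
Proof.
  intros [[H| <-] HPI]; [|rewrite sin_0; lra].
  destruct (MVT_cor2 (fun z => sin z - z * cos z) (fun z => z * sin z) 0 x H)
    as (z & E & Hz).
  - intros z _.
    replace (z * sin z) with (cos z - (1 * cos z + z * - sin z)) by ring.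
    apply derivable_pt_lim_minus with (f1 := sin) (f2 := fun z => z * cos z);
      [apply derivable_pt_lim_sin|].
    apply derivable_pt_lim_mult with (f1 := fun z => z) (f2 := cos);
      [apply derivable_pt_lim_id | apply derivable_pt_lim_cos].
  - rewrite sin_0 in E. assert (0 <= sin z) by (apply sin_ge_0; lra).
    assert (0 <= z * sin z * (x - 0)) by (repeat apply Rmult_le_pos; lra). lra.
Qed.

Lemma polar_first_quadrant (X Y : R) :
  0 < X -> 0 <= Y ->
  exists y rho, 0 <= y < PI / 2 /\ 0 < rho /\ X = rho * cos y /\ Y = rho * sin y.
Proof.
  intros HX HY. pose proof (atan_bound (Y / X)) as Hb. set (y := atan (Y / X)) in *.
  assert (Hy : 0 <= y).
  { unfold y. assert (H : 0 <= Y / X) by (now apply Rle_mult_inv_pos).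
    destruct H as [H| <-]; [|rewrite atan_0; lra].
    rewrite <- atan_0. now apply Rlt_le, atan_increasing. }
  assert (Hc : 0 < cos y) by (apply cos_gt_0; lra).
  exists y, (X / cos y). repeat split; [lra | lra | now apply Rdiv_lt_0_compat | field; lra |].
  assert (E : sin y = Y / X * cos y).
  { rewrite <- (tan_atan (Y / X)). fold y. unfold tan. field. lra. }
  rewrite E. field. lra.
Qed.

(* With [y = arctan (r / n)], [n * y] is within [r ^ 3 / n ^ 2] of [r]. *)
Lemma scaled_angle_bounds (n r y rho : R) :
  0 < n -> 0 <= r -> 0 <= y < PI / 2 -> 0 < rho -> n = rho * cos y -> r = rho * sin y ->
  r - r ^ 3 / n ^ 2 <= n * y <= r.
Proof.
  intros Hn Hr Hy Hrho En Er.
  assert (Hc : 0 < cos y) by nra.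
  assert (Hs : 0 <= sin y) by nra.
  pose proof (sin_le_id y (proj1 Hy)) as H1.
  assert (H2 : y * cos y <= sin y) by (apply id_cos_le_sin; lra).
  pose proof (COS_bound y) as Hc1.
  pose proof (sin2_cos2 y) as Hsc. unfold Rsqr in Hsc.
  split.
  - replace (r ^ 3 / n ^ 2) with (rho * (sin y * (sin y * sin y) / (cos y * cos y)))
      by (rewrite En, Er; field; split; lra).
    rewrite En, Er.
    enough (sin y - y * cos y <= sin y * (sin y * sin y) / (cos y * cos y)) by nra.
    (* The first inequality is [sin y <= y] times [cos y]. The second, once [cos y * cos y] is
       cleared and [sin y * sin y] factored, reduces to [cos y * cos y <= 1 + cos y]. *)
    apply Rle_trans with (sin y * (1 - cos y)); [nra|].
    apply Rmult_le_reg_r with (cos y * cos y); [nra|].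
    replace (sin y * (sin y * sin y) / (cos y * cos y) * (cos y * cos y))
      with (sin y * (sin y * sin y)) by (field; lra).
    replace (sin y * sin y) with ((1 - cos y) * (1 + cos y)) by lra.
    assert (0 <= sin y * (1 - cos y)) by (apply Rmult_le_pos; lra). nra.
  - rewrite En, Er. nra.
Qed.

Lemma denotes_rat_nat (b c : nat) :
  denotes_rat (cpair (2 * c) b) (INR c / INR (S b)).
Proof.
  exists (Z.of_nat c), b. split; [|now rewrite INR_IZR_INZ].
  f_equal. destruct c; simpl zenc; lia.
Qed.
Lemma Rabs_le_inv (x e : R) : Rabs x <= e -> - e <= x <= e.
Proof. unfold Rabs. destruct (Rcase_abs x); lra. Qed.

Lemma computable_real_angle (n X Y : nat) (y rho : R) :
  0 <= y <= PI / 2 -> 0 < rho -> INR X = rho * cos y -> INR Y = rho * sin y ->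
  computable_real (INR n * (y / PI)).
Proof.
  intros Hy Hrho HX HY.
  (* On input [cpair k d] this makes [S (b x)] equal to [(n + 1) * (d + 1)]. After that many
     rotations the error is at most [n / ((n + 1) * (d + 1))], strictly below [1 / (d + 1)]. *)
  set (b := fun x => (n + S n * csnd x)%nat).
  set (C := fun x => half_turns X Y (S (b x))).
  assert (Hc : computable (fun x => cpair (2 * (n * C x)) (b x))).
  { assert (Hb : computable b) by (unfold b; auto with computable).
    assert (HC : computable C)
      by (unfold C; apply computable_half_turns; auto with computable).
    auto with computable. }
  destruct Hc as [p Hp]. exists p. intros k d.
  set (x := cpair k d).
  exists (cpair (2 * (n * C x)) (b x)), (INR (n * C x) / INR (S (b x))).
  split; [apply Hp|]. split; [apply denotes_rat_nat|].
  pose proof (half_turns_approx X Y y rho (S (b x)) Hy Hrho HX HY) as H.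
  fold (C x) in H. apply Rabs_le_inv in H.
  assert (EK : INR (S (b x)) = INR (S n) * INR (S d)).
  { unfold b, x. rewrite csnd_cpair, <- mult_INR. f_equal. lia. }
  rewrite EK in *. rewrite mult_INR, !S_INR in *.
  pose proof (pos_INR n) as Hn. pose proof (pos_INR d) as Hd. pose proof (pos_INR k) as Hk.
  set (N := INR n) in *. set (d' := INR d + 1) in *.
  assert (Hd' : 0 < d') by (unfold d'; lra).
  set (q := y / PI) in *. set (c := INR (C x)) in *.
  assert (Hlt : Rabs (N * c / ((N + 1) * d') - N * q) < 1 / d').
  { replace (N * c / ((N + 1) * d') - N * q)
      with (N / (N + 1) * ((c - (N + 1) * d' * q) * / d')) by (field; lra).
    assert (Hi : 0 < / d') by (now apply Rinv_0_lt_compat).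
    assert (HN : 0 <= N / (N + 1) < 1).
    { split; [apply Rle_mult_inv_pos; lra|]. apply Rmult_lt_reg_r with (N + 1); [lra|].
      unfold Rdiv. rewrite Rmult_assoc, Rinv_l; lra. }
    unfold Rdiv at 2. rewrite Rmult_1_l. rewrite !Rabs_mult.
    rewrite (Rabs_right (N / (N + 1))), (Rabs_right (/ d')) by lra.
    assert (Ha : Rabs (c - (N + 1) * d' * q) <= 1) by (apply Rabs_le; lra).
    pose proof (Rabs_pos (c - (N + 1) * d' * q)).
    apply Rle_lt_trans with (N / (N + 1) * / d').
    - apply Rmult_le_compat_l; [lra|]. nra.
    - nra. }
  apply Rlt_le_trans with (1 := Hlt). apply Rmult_le_compat_r; [|lra].
  apply Rlt_le, Rinv_0_lt_compat, Hd'.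
Qed.

(* For [w] of the order of the required precision, the oracle locates [PI * l] in
   [((j - 1) / w, j / w)]; then [l] is close to [w * arctan (j / w ^ 2) / PI], which is
   approximated by counting the half turns made by [w ^ 2] rotations. *)
Lemma computable_real_of_angle_test (a b c : Z) (theta l : R) :
  positivity6_decidable ->
  (0 < c)%Z -> IZR a = IZR c * cos theta -> IZR b = IZR c * sin theta ->
  0 <= l <= 1 / 2 ->
  (forall r, 0 <= r -> r < PI * l -> angle_test theta r) ->
  (forall r, PI * l < r -> ~ angle_test theta r) ->
  computable_real l.
Proof.
  intros Hdec Hc Ha Hb Hl Hpass Hfail.
  pose proof PI_4 as HPI4. pose proof PI2_1 as HPI2.
  (* Here [w = S (e x)] is [12 * (d + 1)]. The total error will be at most [4 / w]: [1 / w] from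
     counting and [3 / w] from replacing [PI * l] by [w * y]. Having [w >= 12] also gives
     [r ^ 3 <= 27 <= 3 * w]. *)
  set (e := fun x => (12 * csnd x + 11)%nat).
  assert (He : forall f, computable f -> computable (fun x => e (f x)))
    by (intros f Hf; unfold e; auto with computable).
  destruct (angle_test_decidable a b c theta (fun z => S (e (cfst z))) csnd Hdec Hc Ha Hb)
    as [p Hp]; [auto with computable | auto using computable_csnd, computable_id | lia |].
  (* The Gaussian integer [w ^ 2 + j i] is [w + (j / w) i] scaled by [w]. Its [w ^ 2] rotations give
     [w ^ 2 * y / PI] up to [1], hence [w * y / PI] up to [1 / w]. *)
  set (C := fun x j => half_turns (S (e x) * S (e x)) j (S (e x) * S (e x))).
  assert (Hout : computable (fun z => cpair (2 * C (cfst z) (csnd z)) (e (cfst z)))).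
  { apply computable_pair; [|auto with computable].
    apply computable_mul; [apply computable_const|].
    unfold C. apply computable_half_turns; auto 7 with computable. }
  destruct Hout as [g Hg].
  exists (PComp g (PPair PId (PMu p))). intros k d. set (x := cpair k d).
  set (w := INR (S (e x))).
  assert (Ew : w = 12 * (INR d + 1)).
  { unfold w, e, x. rewrite csnd_cpair, S_INR, plus_INR, mult_INR. simpl. ring. }
  pose proof (pos_INR d) as Hd. pose proof (pos_INR k) as Hk.
  assert (Hw : 12 <= w) by lra.
  (* The test program returns [1] on success and [0] on failure, so minimization stops at the first
     failing [j]. *)
  destruct (least_witness (fun j => ~ angle_test theta (INR j / w))) as (j & Hj & Hmin).
  { destruct (INR_unbounded (PI * l * w)) as [j Hj]. exists j. apply Hfail.
    apply Rmult_lt_reg_r with w; [lra|].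
    replace (INR j / w * w) with (INR j) by (field; lra). lra. }
  assert (Hmu : eval (PMu p) x j).
  { constructor.
    - destruct (Hp (cpair x j)) as [_ H]. rewrite cfst_cpair, csnd_cpair in H.
      apply H, Hj.
    - intros m Hm. exists 0%nat.
      destruct (Hp (cpair x m)) as [H _]. rewrite cfst_cpair, csnd_cpair in H.
      apply H. specialize (Hmin m Hm). now apply NNPP. }
  exists (cpair (2 * C x j) (e x)), (INR (C x j) / w).
  split; [|split; [apply denotes_rat_nat|]].
  { apply ev_comp with (cpair x j); [constructor; [constructor | exact Hmu]|].
    specialize (Hg (cpair x j)). cbv beta in Hg. now rewrite cfst_cpair, csnd_cpair in Hg. }
  set (r := INR j / w) in *.
  assert (Hr0 : 0 <= r) by (apply Rle_mult_inv_pos; [apply pos_INR | lra]).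
  assert (Hrl : PI * l <= r).
  { destruct (Rle_lt_dec (PI * l) r) as [H|H]; [exact H|]. contradiction (Hj (Hpass r Hr0 H)). }
  assert (Hru : r <= PI * l + 1 / w).
  { destruct j as [|j].
    - unfold r. simpl. assert (0 < 1 / w) by (apply Rdiv_lt_0_compat; lra). nra.
    - specialize (Hmin j (Nat.lt_succ_diag_r j)). apply NNPP in Hmin.
      destruct (Rle_lt_dec (INR j / w) (PI * l)) as [H|H]; [|contradiction (Hfail _ H)].
      unfold r. rewrite S_INR. unfold Rdiv in *. lra. }
  assert (Hw1 : 0 < 1 / w) by (apply Rdiv_lt_0_compat; lra).
  assert (Hw12 : 1 / w <= 1).
  { apply Rmult_le_reg_r with w; [lra|]. unfold Rdiv. rewrite Rmult_assoc, Rinv_l; lra. }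
  assert (Hr3 : r <= 3) by nra.
  destruct (polar_first_quadrant w r) as (y & rho & Hy & Hrho & EX & EY); [lra | lra |].
  destruct (scaled_angle_bounds w r y rho) as [Hlo Hhi]; try lra.
  assert (Hcube : r ^ 3 / w ^ 2 <= 3 * (1 / w)).
  { replace (3 * (1 / w)) with (3 * w / w ^ 2) by (field; lra).
    apply Rmult_le_compat_r.
    - apply Rlt_le, Rinv_0_lt_compat. apply pow_lt. lra.
    - assert (r ^ 3 <= 3 ^ 3) by (apply pow_incr; lra). lra. }
  pose proof (half_turns_approx (S (e x) * S (e x)) j y (w * rho) (S (e x) * S (e x))) as H.
  fold (C x j) in H. rewrite mult_INR in H. fold w in H.
  assert (HC : Rabs (INR (C x j) - w * w * (y / PI)) <= 1).
  { apply H; [lra | nra | rewrite EX at 2; ring |].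
    replace (INR j) with (w * r) by (unfold r; field; lra). rewrite EY. ring. }
  apply Rabs_le_inv in HC.
  assert (HCw : Rabs (INR (C x j) / w - w * (y / PI)) <= 1 / w).
  { replace (INR (C x j) / w - w * (y / PI))
      with ((INR (C x j) - w * w * (y / PI)) * (1 / w)) by (field; lra).
    rewrite Rabs_mult, (Rabs_right (1 / w)) by lra.
    apply Rle_trans with (1 * (1 / w)); [|lra].
    apply Rmult_le_compat_r; [lra | now apply Rabs_le]. }
  assert (Hyl : Rabs (w * (y / PI) - l) <= 3 * (1 / w)).
  { replace (w * (y / PI) - l) with ((w * y - PI * l) * / PI) by (field; lra).
    assert (HiPI : 0 < / PI <= 1).
    { split; [apply Rinv_0_lt_compat; lra|]. rewrite <- Rinv_1. apply Rinv_le_contravar; lra. }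
    rewrite Rabs_mult, (Rabs_right (/ PI)) by lra.
    assert (Rabs (w * y - PI * l) <= 3 * (1 / w)) by (apply Rabs_le; lra).
    pose proof (Rabs_pos (w * y - PI * l)). nra. }
  apply Rabs_le_inv in HCw. apply Rabs_le_inv in Hyl.
  apply Rlt_le_trans with (1 / INR (S d)).
  - rewrite S_INR.
    replace (1 / (INR d + 1)) with (12 * (1 / w)) by (rewrite Ew; field; lra).
    apply Rabs_def1; lra.
  - rewrite !S_INR. apply Rmult_le_compat_r; [|lra].
    apply Rlt_le, Rinv_0_lt_compat. lra.
Qed.

(** * Reduction modulo full turns, and the type as an infimum over positive denominators *)

Lemma cos_sub_turns (x : R) (m : Z) : cos (x - 2 * IZR m * PI) = cos x.
Proof.
  destruct (Z_le_gt_dec 0 m) as [H|H].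
  - rewrite <- (cos_period _ (Z.to_nat m)). f_equal.
    rewrite INR_IZR_INZ, Z2Nat.id by lia. ring.
  - rewrite <- (cos_period x (Z.to_nat (- m))). f_equal.
    rewrite INR_IZR_INZ, Z2Nat.id, opp_IZR by lia. ring.
Qed.

Lemma sin_sub_turns (x : R) (m : Z) : sin (x - 2 * IZR m * PI) = sin x.
Proof.
  destruct (Z_le_gt_dec 0 m) as [H|H].
  - rewrite <- (sin_period _ (Z.to_nat m)). f_equal.
    rewrite INR_IZR_INZ, Z2Nat.id by lia. ring.
  - rewrite <- (sin_period x (Z.to_nat (- m))). f_equal.
    rewrite INR_IZR_INZ, Z2Nat.id, opp_IZR by lia. ring.
Qed.

Lemma nearest_integer (x : R) :
  exists m : Z, Rabs (x - IZR m) <= 1 / 2 /\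
    forall m' : Z, Rabs (x - IZR m) <= Rabs (x - IZR m').
Proof.
  destruct (archimed (x - 1 / 2)) as [H1 H2]. set (m := up (x - 1 / 2)) in *.
  assert (Hm : Rabs (x - IZR m) <= 1 / 2) by (apply Rabs_le; lra).
  exists m. split; [exact Hm|]. intro m'.
  destruct (Z.eq_dec m m') as [<-|Hne]; [lra|].
  assert (H : 1 <= Rabs (IZR m - IZR m')).
  { rewrite <- minus_IZR, <- abs_IZR. apply IZR_le. lia. }
  pose proof (Rabs_triang (IZR m - x) (x - IZR m')) as Ht.
  replace (IZR m - x + (x - IZR m')) with (IZR m - IZR m') in Ht by ring.
  rewrite Rabs_minus_sym in Ht. rewrite (Rabs_minus_sym x (IZR m')) in *.
  rewrite (Rabs_minus_sym (IZR m) x) in Ht. rewrite Rabs_minus_sym in H.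
  lra.
Qed.

Definition quality (t : R) (n : nat) (m : Z) : R := INR n * Rabs (INR n * t - IZR m).

Lemma quality_opp (t : R) (n : nat) (m : Z) : quality (- t) n m = quality t n (- m).
Proof.
  unfold quality. rewrite opp_IZR, <- Rabs_Ropp. do 2 f_equal. ring.
Qed.

(** Completeness is applied to the negated values. The bound [1 / 2] comes from [n = 1] and the
    integer nearest to [t]. *)
Lemma quality_inf (t : R) :
  exists l, 0 <= l <= 1 / 2 /\
    (forall n m, (0 < n)%nat -> l <= quality t n m) /\
    (forall c, l < c -> exists n m, (0 < n)%nat /\ quality t n m < c).
Proof.
  set (E := fun v => exists n m, (0 < n)%nat /\ v = - quality t n m).
  assert (HE0 : is_upper_bound E 0).
  { intros v (n & m & _ & ->). unfold quality.
    pose proof (Rmult_le_pos _ _ (pos_INR n) (Rabs_pos (INR n * t - IZR m))). lra. }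
  destruct (nearest_integer t) as (m1 & Hm1 & _).
  assert (H1 : E (- quality t 1 m1)) by (exists 1%nat, m1; auto).
  destruct (completeness E) as [l' [Hub Hlub]]; [now exists 0 | eexists; exact H1 |].
  exists (- l'). repeat split.
  - specialize (Hlub 0 HE0). lra.
  - apply Hub in H1. unfold quality in H1. simpl INR in H1.
    rewrite !Rmult_1_l in H1. lra.
  - intros n m Hn. assert (H : E (- quality t n m)) by (now exists n, m).
    apply Hub in H. lra.
  - intros c Hc. apply NNPP. intro Hno.
    enough (l' <= - c) by lra. apply Hlub. intros v (n & m & Hn & ->).
    destruct (Rlt_le_dec (quality t n m) c) as [H|H]; [|lra].
    contradiction Hno. now exists n, m.
Qed.

Lemma approx_set_iff (t c : R) :
  approx_set t c <-> exists n m, (0 < n)%nat /\ quality t n m < c.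
Proof.
  assert (E : forall n m : Z, m <> 0%Z ->
    Rabs (t - IZR n / IZR m) * IZR m ^ 2 = Rabs (IZR m) * Rabs (IZR m * t - IZR n)).
  { intros n m Hm. apply eq_IZR_contrapositive in Hm.
    rewrite <- (Rabs_right (IZR m ^ 2)) by (apply Rle_ge, pow2_ge_0).
    rewrite <- !Rabs_mult. f_equal. field. exact Hm. }
  assert (Hpos : forall m : Z, m <> 0%Z -> 0 < IZR m ^ 2).
  { intros m Hm. apply eq_IZR_contrapositive in Hm. rewrite <- Rsqr_pow2. now apply Rsqr_pos_lt. }
  assert (Hiff : forall n m : Z, m <> 0%Z ->
    Rabs (t - IZR n / IZR m) < c / IZR m ^ 2 <->
    Rabs (IZR m) * Rabs (IZR m * t - IZR n) < c).
  { intros n m Hm. rewrite <- (E n m Hm). specialize (Hpos m Hm). split; intro H.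
    - apply Rmult_lt_compat_r with (r := IZR m ^ 2) in H; [|exact Hpos].
      unfold Rdiv in H at 2. rewrite Rmult_assoc, Rinv_l in H; lra.
    - apply Rmult_lt_reg_r with (IZR m ^ 2); [exact Hpos|].
      unfold Rdiv at 2. rewrite Rmult_assoc, Rinv_l; lra. }
  split.
  - intros (n & m & Hm & H). apply Hiff in H; [|exact Hm].
    (* The sign of the denominator is moved to the numerator. *)
    exists (Z.abs_nat m), (Z.sgn m * n)%Z. split; [lia|].
    unfold quality. rewrite INR_IZR_INZ, Zabs2Nat.id_abs, abs_IZR.
    destruct (Z_lt_le_dec 0 m) as [Hp|Hp].
    + rewrite Z.sgn_pos, Z.mul_1_l by lia. apply IZR_lt in Hp.
      rewrite (Rabs_right (IZR m)) at 2 by lra. exact H.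
    + rewrite Z.sgn_neg by lia. apply IZR_le in Hp. rewrite mult_IZR.
      rewrite (Rabs_left1 (IZR m)) at 2 by lra.
      rewrite <- (Rabs_Ropp (IZR m * t - IZR n)) in H.
      replace (- IZR m * t - -1 * IZR n) with (- (IZR m * t - IZR n)) by ring. exact H.
  - intros (n & m & Hn & H). exists m, (Z.of_nat n). split; [lia|].
    apply Hiff; [lia|]. rewrite <- INR_IZR_INZ.
    rewrite (Rabs_right (INR n)) by (apply Rle_ge, pos_INR). exact H.
Qed.

Lemma dio_type_inf (t l : R) :
  (forall n m, (0 < n)%nat -> l <= quality t n m) ->
  (forall c, l < c -> exists n m, (0 < n)%nat /\ quality t n m < c) ->
  dio_type t l.
Proof.
  intros Hlow Hinf. split.
  - intros c Hc. apply approx_set_iff in Hc. destruct Hc as (n & m & Hn & H).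
    specialize (Hlow n m Hn). lra.
  - intros l' Hl'. destruct (Rle_lt_dec l' l) as [H|H]; [exact H|].
    enough (l' <= (l + l') / 2) by lra. apply Hl', approx_set_iff, Hinf. lra.
Qed.

(** The sum of the real number [C] and a vector of length [C] bisects their angle: [C + A + |B| i]
    has argument [y] and modulus [2 * C * cos y]. It vanishes for [y = PI / 2], where [i] serves
    instead. *)
Lemma half_angle_vector (A B C : Z) (y : R) :
  0 <= y <= PI / 2 -> (0 < C)%Z ->
  IZR A = IZR C * cos (2 * y) -> Rabs (IZR B) = IZR C * sin (2 * y) ->
  exists (X Y : nat) (rho : R), 0 < rho /\ INR X = rho * cos y /\ INR Y = rho * sin y.
Proof.
  intros Hy HC HA HB. apply IZR_lt in HC.
  destruct (Req_dec y (PI / 2)) as [->|Hne].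
  - exists 0%nat, 1%nat, 1. rewrite cos_PI2, sin_PI2. simpl. lra.
  - assert (Hc : 0 < cos y) by (apply cos_gt_0; lra).
    rewrite cos_2a_cos in HA. rewrite sin_2a in HB.
    exists (Z.to_nat (C + A)), (Z.abs_nat B), (2 * IZR C * cos y). repeat split.
    + repeat apply Rmult_lt_0_compat; lra.
    + rewrite INR_IZR_INZ, Z2Nat.id.
      * rewrite plus_IZR, HA. ring.
      * apply le_IZR. rewrite plus_IZR, HA.
        replace (IZR C + _) with (2 * IZR C * (cos y * cos y)) by ring. nra.
    + rewrite INR_IZR_INZ, Zabs2Nat.id_abs, abs_IZR, HB. ring.
Qed.

(** Here [l = n * y / PI], and [2 * y] is up to sign and full turns the argument of [(a + b i) ^ n].
    Halving it by [half_angle_vector] gives a Gaussian integer of argument [y]. *)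
Lemma computable_real_attained (a b c : Z) (t l : R) (n : nat) (m : Z) :
  (0 < c)%Z -> IZR a = IZR c * cos (2 * PI * t) -> IZR b = IZR c * sin (2 * PI * t) ->
  (forall m, l <= quality t n m) -> (0 < n)%nat -> quality t n m = l ->
  computable_real l.
Proof.
  intros Hc Ha Hb Hlow Hn Hl. pose proof PI_RGT_0 as HPI.
  set (y := PI * Rabs (INR n * t - IZR m)).
  assert (Hn' : 0 < INR n) by (now apply lt_0_INR).
  assert (Hy : 0 <= y <= PI / 2).
  { destruct (nearest_integer (INR n * t)) as (m' & Hm' & _).
    specialize (Hlow m'). rewrite <- Hl in Hlow. unfold quality in Hlow.
    apply Rmult_le_reg_l in Hlow; [|exact Hn'].
    pose proof (Rabs_pos (INR n * t - IZR m)). unfold y. split; [nra|].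
    unfold Rdiv. apply Rmult_le_compat_l; lra. }
  destruct (gauss_pow_polar a b (IZR c) (2 * PI * t) n Ha Hb) as [EA EB].
  rewrite pow_IZR in EA, EB.
  set (z := 2 * PI * (INR n * t - IZR m)).
  assert (Ez : INR n * (2 * PI * t) - 2 * IZR m * PI = z) by (unfold z; ring).
  rewrite <- (cos_sub_turns _ m), Ez in EA. rewrite <- (sin_sub_turns _ m), Ez in EB.
  assert (Hcn : (0 < c ^ Z.of_nat n)%Z) by (apply Z.pow_pos_nonneg; lia).
  destruct (half_angle_vector (fst (gauss_pow a b n)) (snd (gauss_pow a b n))
    (c ^ Z.of_nat n) y Hy Hcn) as (X & Y & rho & Hrho & HX & HY).
  - rewrite EA. f_equal. unfold y, z, Rabs. destruct Rcase_abs.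
    + rewrite <- cos_neg. f_equal. ring.
    + f_equal. ring.
  - rewrite EB, Rabs_mult. apply IZR_lt in Hcn. rewrite Rabs_right by lra. f_equal.
    assert (Hs : 0 <= sin (2 * y)) by (apply sin_ge_0; lra).
    assert (E : 2 * y = z \/ 2 * y = - z).
    { unfold y, z, Rabs. destruct Rcase_abs; [right | left]; ring. }
    destruct E as [E|E]; rewrite E in *; [apply Rabs_right; lra|].
    rewrite sin_neg in *. apply Rabs_left1. lra.
  - replace l with (INR n * (y / PI)).
    + exact (computable_real_angle n X Y y rho Hy Hrho HX HY).
    + rewrite <- Hl. unfold quality, y. field. lra.
Qed.

(** * Success and failure of the angle test on either side of [PI * l] *)

Lemma angle_test_defect (t r : R) (n : nat) (m : Z) :
  let z := PI * (INR n * t - IZR m) in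
  INR n * (1 - cos (INR n * (2 * PI * t))) - r * sin (INR n * (2 * PI * t))
  = 2 * sin z * (INR n * sin z - r * cos z).
Proof.
  intro z. rewrite <- (cos_sub_turns _ m), <- (sin_sub_turns _ m).
  replace (INR n * (2 * PI * t) - 2 * IZR m * PI) with (2 * z) by (unfold z; ring).
  rewrite cos_2a_sin, sin_2a. ring.
Qed.

(** With [m] nearest to [n * t], [|z| <= PI / 2] and [r <= n * |z|]. For [z >= 0],
    [r * cos z <= n * z * cos z <= n * sin z], so both factors of the defect are nonnegative; for
    [z < 0] both are nonpositive. *)
Lemma angle_test_pass (t l r : R) :
  (forall n m, (0 < n)%nat -> l <= quality t n m) ->
  0 <= r -> r <= PI * l -> angle_test (2 * PI * t) r.
Proof.
  intros Hlow Hr Hrl n. pose proof PI_RGT_0 as HPI.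
  destruct n as [|n0]; [simpl; rewrite !Rmult_0_l, sin_0; lra|].
  set (n := S n0). assert (Hn : (0 < n)%nat) by (unfold n; lia).
  apply lt_INR in Hn as Hn'. simpl (INR 0) in Hn'.
  destruct (nearest_integer (INR n * t)) as (m & Hm & _).
  specialize (Hlow n m Hn). unfold quality in Hlow.
  pose proof (angle_test_defect t r n m) as E. cbv zeta in E.
  set (z := PI * (INR n * t - IZR m)) in *.
  assert (Hz : Rabs z <= PI / 2).
  { unfold z. rewrite Rabs_mult, Rabs_right by lra.
    unfold Rdiv. apply Rmult_le_compat_l; lra. }
  assert (Hrz : r <= INR n * Rabs z).
  { unfold z. rewrite Rabs_mult, (Rabs_right PI) by lra. nra. }
  clearbody z. enough (0 <= 2 * sin z * (INR n * sin z - r * cos z)) by lra.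
  assert (Hmain : forall z, 0 <= z <= PI / 2 -> r <= INR n * z ->
    0 <= sin z /\ r * cos z <= INR n * sin z).
  { clear - Hn' HPI Hr. intros z Hz Hrz. split; [apply sin_ge_0; lra|].
    assert (H1 : z * cos z <= sin z) by (apply id_cos_le_sin; lra).
    assert (H2 : 0 <= cos z) by (apply cos_ge_0; lra).
    apply Rle_trans with (INR n * z * cos z); nra. }
  unfold Rabs in *. destruct (Rcase_abs z).
  - destruct (Hmain (- z)) as [H1 H2]; [lra | lra |].
    rewrite sin_neg in *. rewrite cos_neg in *.
    assert (0 <= cos z) by (apply cos_ge_0; lra).
    assert (0 <= r * cos z) by (now apply Rmult_le_pos).
    replace (2 * sin z * (INR n * sin z - r * cos z))
      with (2 * - sin z * (INR n * - sin z + r * cos z)) by ring.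
    apply Rmult_le_pos; nra.
  - destruct (Hmain z) as [H1 H2]; [lra | lra |]. apply Rmult_le_pos; lra.
Qed.

(** Where the sine is nonnegative, decreasing [r] lowers the left side; where it is negative, the
    left side stays nonpositive while the right side is nonnegative. *)
Lemma angle_test_mono (theta r r' : R) :
  r' <= r -> 0 <= r' -> angle_test theta r -> angle_test theta r'.
Proof.
  intros Hr Hr' H n. specialize (H n).
  pose proof (COS_bound (INR n * theta)). pose proof (pos_INR n).
  assert (0 <= INR n * (1 - cos (INR n * theta))) by (apply Rmult_le_pos; lra).
  destruct (Rle_lt_dec 0 (sin (INR n * theta))); nra.
Qed.

(** For each [n] the minimum over [m] is reached at the nearest integer, so finitely many [n] stay
    away from an unattained infimum. Approximations close enough to [l] thus have [n >= N]. *)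
Lemma quality_gap (t l : R) (N : nat) :
  (forall n m, (0 < n)%nat -> l < quality t n m) ->
  exists e, l < e /\ forall n m, (0 < n < N)%nat -> e <= quality t n m.
Proof.
  intro Hlow. induction N as [|N (e & He & IH)].
  - exists (l + 1). split; [lra | lia].
  - destruct (Nat.eq_0_gt_0_cases N) as [->|HN]; [exists e; split; [exact He | lia]|].
    destruct (nearest_integer (INR N * t)) as (m0 & _ & Hm0).
    exists (Rmin e (quality t N m0)). split; [apply Rmin_glb_lt; auto|].
    intros n m Hn. destruct (Nat.eq_dec n N) as [->|Hne].
    + apply Rle_trans with (1 := Rmin_r _ _). unfold quality.
      apply Rmult_le_compat_l; [apply pos_INR | apply Hm0].
    + apply Rle_trans with (1 := Rmin_l _ _). apply IH. lia.
Qed.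

(* For large [n] the angle [z = PI * (n * t - m)] is small, so that [tan z] is nearly [z];
   the sign of [z] decides which of the two tests fails. *)
Lemma angle_test_fail (t l r : R) :
  0 <= l -> (forall n m, (0 < n)%nat -> l < quality t n m) ->
  (forall c, l < c -> exists n m, (0 < n)%nat /\ quality t n m < c) ->
  PI * l < r ->
  ~ angle_test (2 * PI * t) r \/ ~ angle_test (2 * PI * - t) r.
Proof.
  intros Hl Hlow Hinf Hr. pose proof PI_RGT_0 as HPI. pose proof PI2_1 as HPI1.
  set (k := (PI * l + r) / 2).
  assert (Hk : PI * l < k < r) by (unfold k; lra).
  assert (Hk0 : 0 <= k) by nra.
  (* The first summand forces [|z| < 1], the second [|z| * r <= r - k], once [n >= N] and
     [n * |z| < k]. *)
  destruct (INR_unbounded (k + k * r / (r - k))) as [N HN].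
  assert (HN1 : k <= INR N).
  { assert (0 <= k * r / (r - k)) by (apply Rle_mult_inv_pos; nra). lra. }
  assert (HN2 : k * r <= INR N * (r - k)).
  { apply Rle_trans with (k * r / (r - k) * (r - k)).
    - apply Req_le. field. lra.
    - apply Rmult_le_compat_r; lra. }
  destruct (quality_gap t l N Hlow) as (e & He & Hgap).
  destruct (Hinf (Rmin e (k / PI))) as (n & m & Hn & Hq).
  { apply Rmin_glb_lt; [exact He|]. apply Rmult_lt_reg_r with PI; [lra|].
    unfold Rdiv. rewrite Rmult_assoc, Rinv_l; lra. }
  assert (HNn : (N <= n)%nat).
  { destruct (Nat.le_gt_cases N n) as [H|H]; [exact H|].
    specialize (Hgap n m (conj Hn H)). pose proof (Rmin_l e (k / PI)). lra. }
  apply le_INR in HNn. apply lt_INR in Hn as Hn'. simpl (INR 0) in Hn'.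
  assert (Hqk : INR n * (PI * Rabs (INR n * t - IZR m)) < k).
  { pose proof (Rmin_r e (k / PI)). unfold quality in Hq.
    replace k with (PI * (k / PI)) by (field; lra). nra. }
  assert (Hz0 : 0 < PI * Rabs (INR n * t - IZR m)).
  { specialize (Hlow n m Hn). unfold quality in Hlow. apply Rmult_lt_0_compat; [lra|].
    pose proof (Rabs_pos (INR n * t - IZR m)). nra. }
  assert (Hmain : forall t m, 0 < PI * (INR n * t - IZR m) ->
    INR n * (PI * (INR n * t - IZR m)) < k ->
    ~ angle_test (2 * PI * t) r).
  { clear - Hn' HNn HN1 HN2 Hk Hk0 HPI HPI1. intros t m Hz Hnz H. specialize (H n).
    pose proof (angle_test_defect t r n m) as E. cbv zeta in E.
    set (z := PI * (INR n * t - IZR m)) in *. clearbody z.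
    assert (Hz1 : z < 1) by nra.
    assert (Hzr : z * r <= r - k).
    { apply Rmult_le_reg_l with (INR n); [exact Hn'|].
      apply Rle_trans with (k * r); nra. }
    assert (Hs : 0 < sin z) by (apply sin_gt_0; lra).
    assert (Hsz : sin z <= z) by (apply sin_le_id; lra).
    assert (Hcos : 1 - z * z / 2 <= cos z).
    { replace z with (2 * (z / 2)) at 3 by field. rewrite cos_2a_sin.
      assert (0 <= sin (z / 2)) by (apply sin_ge_0; lra).
      assert (sin (z / 2) <= z / 2) by (apply sin_le_id; lra). nra. }
    assert (Hrc : k <= r * cos z).
    { apply Rle_trans with (r * (1 - z * z / 2)); [|apply Rmult_le_compat_l; lra].
      assert (z * z * r <= z * r) by nra. nra. }
    (* The chain is [n * sin z <= n * z < k <= r * cos z]. *)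
    assert (Hd : INR n * sin z - r * cos z < 0) by nra.
    nra. }
  destruct (Rle_lt_dec 0 (INR n * t - IZR m)) as [H|H].
  - left. rewrite Rabs_right in Hqk, Hz0 by lra.
    apply (Hmain t m); [exact Hz0 | exact Hqk].
  - right. rewrite Rabs_left in Hqk, Hz0 by lra.
    assert (E : INR n * - t - IZR (- m) = - (INR n * t - IZR m))
      by (rewrite opp_IZR; ring).
    apply (Hmain (- t) (- m)%Z); rewrite E; [exact Hz0 | exact Hqk].
Qed.

(** If the test for [t] succeeds at some [r0 > PI * l], then the test for [- t] fails at every
    [r > PI * l]: otherwise both would succeed at [Rmin r r0]. The choice of sign is classical, but
    each choice yields a program. *)
Lemma computable_real_unattained (a b c : Z) (t l : R) :
  positivity6_decidable ->
  (0 < c)%Z -> IZR a = IZR c * cos (2 * PI * t) -> IZR b = IZR c * sin (2 * PI * t) ->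
  0 <= l <= 1 / 2 -> (forall n m, (0 < n)%nat -> l < quality t n m) ->
  (forall c, l < c -> exists n m, (0 < n)%nat /\ quality t n m < c) ->
  computable_real l.
Proof.
  intros Hdec Hc Ha Hb Hl Hlow Hinf. pose proof PI_RGT_0 as HPI.
  assert (Hfail : forall r, PI * l < r ->
    ~ angle_test (2 * PI * t) r \/ ~ angle_test (2 * PI * - t) r)
    by (intro r; apply angle_test_fail; trivial; lra).
  destruct (classic (forall r, PI * l < r -> ~ angle_test (2 * PI * t) r)) as [H|H].
  - apply (computable_real_of_angle_test a b c (2 * PI * t)); trivial.
    intros r Hr Hrl. apply angle_test_pass with l; try lra.
    intros n m Hn. now apply Rlt_le, Hlow.
  - apply not_all_ex_not in H. destruct H as [r0 H]. apply imply_to_and in H.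
    destruct H as [Hr0 H]. apply NNPP in H.
    (* Passing to [- t] conjugates the Gaussian integer. *)
    apply (computable_real_of_angle_test a (- b) c (2 * PI * - t)); trivial.
    + rewrite Ha. f_equal. rewrite <- cos_neg. f_equal. ring.
    + rewrite opp_IZR, Hb. replace (2 * PI * - t) with (- (2 * PI * t)) by ring.
      rewrite sin_neg. ring.
    + intros r Hr Hrl. apply angle_test_pass with l; try lra.
      intros n m Hn. rewrite quality_opp. now apply Rlt_le, Hlow.
    + intros r Hr Hpass.
      assert (Hmin : PI * l < Rmin r r0) by (now apply Rmin_glb_lt).
      assert (H0 : 0 <= PI * l) by (apply Rmult_le_pos; lra).
      destruct (Hfail _ Hmin) as [F|F]; apply F.
      * apply angle_test_mono with r0; [apply Rmin_r | lra | exact H].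
      * apply angle_test_mono with r; [apply Rmin_l | lra | exact Hpass].
Qed.

Lemma rational_pair_denominator (p q : Q) :
  exists a b c : Z, (0 < c)%Z /\ IZR a = IZR c * Q2R p /\ IZR b = IZR c * Q2R q.
Proof.
  destruct p as [n1 d1], q as [n2 d2]. unfold Q2R. simpl.
  exists (n1 * Zpos d2)%Z, (n2 * Zpos d1)%Z, (Zpos d1 * Zpos d2)%Z.
  split; [lia|]. rewrite !mult_IZR.
  split; field; apply eq_IZR_contrapositive; lia.
Qed.

Theorem theorem5p2 :
  positivity6_decidable ->
  forall t : R, in_T t ->
    exists l : R, dio_type t l /\ computable_real l.
Proof.
  intros Hdec t (p & q & _ & _ & _ & theta & _ & _ & Hcos & Hsin & Ht).
  pose proof PI_RGT_0 as HPI.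
  destruct (rational_pair_denominator p q) as (a & b & c & Hc & Ha & Hb).
  rewrite <- Hcos in Ha. rewrite <- Hsin in Hb.
  replace theta with (2 * PI * t) in Ha, Hb by (rewrite Ht; field; lra).
  destruct (quality_inf t) as (l & Hl & Hlow & Hinf).
  exists l. split; [now apply dio_type_inf|].
  (* No algorithm has to tell the two cases apart: [computable_real] asserts only that a program
     exists. *)
  destruct (classic (exists n m, (0 < n)%nat /\ quality t n m = l)) as [(n & m & Hn & E)|Hno].
  - apply (computable_real_attained a b c t l n m); trivial.
    intro m'. now apply Hlow.
  - apply (computable_real_unattained a b c t l); trivial.
    intros n m Hn. destruct (Hlow n m Hn) as [H|H]; [exact H|].
    contradiction Hno. now exists n, m.
Qed.
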